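(* Let $\theta\in(0,1)$. The Dirichlet-Neumann algorithm DN$_2$ converges if and only if $$\rho_{\mathrm{DN}_2}:=\max_{1\le i\le n}\Big|1-\theta\Big(1+\coth(a_i)\frac{\sigma_i\coth(b_i)+\omega_i}{\sigma_i+\omega_i\coth(b_i)}\Big)\Big|<1.$$
   Context: Let $A\in\mathbb{R}^{n\times n}$ be symmetric with eigenvalues $d_1,\dots,d_n$, and let $\nu>0$, $\gamma\ge 0$, $T>0$, $0<\alpha<T$. Set $\Omega_1=(0,\alpha)$, $\Omega_2=(\alpha,T)$, $\sigma_i=\sqrt{d_i^2+\nu^{-1}}$, $\omega_i=\nu^{-1}\gamma+d_i$, $a_i=\sigma_i\alpha$, $b_i=\sigma_i(T-\alpha)$. Algorithm DN$_2$ (error equations): for each $i$, given an initial guess $f_i^0\in\mathbb{R}$, for $k=1,2,\dots$: (1) solve $\dot z_{1,i}^k+d_iz_{1,i}^k-\nu^{-1}\mu_{1,i}^k=0$, $\dot\mu_{1,i}^k-z_{1,i}^k-d_i\mu_{1,i}^k=0$ in $\Omega_1$ with $z_{1,i}^k(0)=0$, $z_{1,i}^k(\alpha)=f_i^{k-1}$; (2) solve $\dot z_{2,i}^k+d_iz_{2,i}^k-\nu^{-1}\mu_{2,i}^k=0$, $\dot\mu_{2,i}^k-z_{2,i}^k-d_i\mu_{2,i}^k=0$ in $\Omega_2$ with $\dot z_{2,i}^k(\alpha)=\dot z_{1,i}^k(\alpha)$, $\mu_{2,i}^k(T)+\gamma z_{2,i}^k(T)=0$; (3) set $f_i^k=(1-\theta)f_i^{k-1}+\theta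 z_{2,i}^k(\alpha)$. Assume all subdomain problems are uniquely solvable for every datum, so that the algorithm is well defined. The algorithm converges if $f_i^k\to 0$ as $k\to\infty$ for every $i$ and every initial guess $(f_1^0,\dots,f_n^0)\in\mathbb{R}^n$. *)

(* Defs.v *)
From HB Require Import structures.
From mathcomp Require Import all_boot all_order all_algebra.
From mathcomp Require Import all_classical all_reals all_analysis.
Import Order.TTheory GRing.Theory Num.Theory.
Import numFieldNormedType.Exports.

Set Implicit Arguments.
Unset Strict Implicit.
Unset Printing Implicit Defensive.

Local Open Scope classical_set_scope.
Local Open Scope ring_scope.


Section DN2.
Context {R : realType}.
Implicit Types (z mu : R -> R) (f g l d t : R).

Definition sinh (x : R) : R := (expR x - expR (- x)) / 2.
Definition cosh (x : R) : R := (expR x + expR (- x)) / 2.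
Definition coth (x : R) : R := cosh x / sinh x.

(* With multiplicity: [d] lists the n roots of the characteristic polynomial. *)
Definition has_eigenvalues (n : nat) (A : 'M[R]_n) (d : 'I_n -> R) : Prop :=
  char_poly A = \prod_(i < n) ('X - (d i)%:P).

Definition is_left_derive z t l : Prop :=
  (z s - z t) / (s - t) @[s --> t^'-] --> l.

Definition is_right_derive z t l : Prop :=
  (z s - z t) / (s - t) @[s --> t^'+] --> l.

Variables (nu gamma T alpha theta : R).

(* Classical solution on the open interval ]x, y[, with boundary values attained
   continuously; the values of [z] and [mu] outside [x, y] are irrelevant. *)
Definition solves_ode d (x y : R) z mu : Prop :=
  [/\ derivable_oo_LRcontinuous z x y,
      derivable_oo_LRcontinuous mu x y &
      forall t, t \in `]x, y[ ->
        (z^`())%classic t + d * z t - nu^-1 * mu t = 0 /\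
        (mu^`())%classic t - z t - d * mu t = 0].

(* Problem on (0, alpha) with Dirichlet datum [f] at the interface. *)
Definition subproblem1 d f z mu : Prop :=
  [/\ solves_ode d 0 alpha z mu, z 0 = 0 & z alpha = f].

(* Problem on (alpha, T) with Neumann datum [g] at the interface; derivatives at
   the interface are one-sided, taken from inside the subdomain. *)
Definition subproblem2 d g z mu : Prop :=
  [/\ solves_ode d alpha T z mu, is_right_derive z alpha g
    & mu T + gamma * z T = 0].

Definition uniquely_solvable (x y : R)
    (P : (R -> R) -> (R -> R) -> Prop) : Prop :=
  (exists z mu, P z mu) /\
  (forall z mu z' mu', P z mu -> P z' mu' ->
     forall t, t \in `[x, y] -> z t = z' t /\ mu t = mu' t).

Definition subproblems_uniquely_solvable d : Prop :=
  (forall f, uniquely_solvable 0 alpha (subproblem1 d f)) /\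
  (forall g, uniquely_solvable alpha T (subproblem2 d g)).

(* One iteration, from the interface value [f] to the interface value [f'].
   It is a relation; it is the graph of a function as soon as
   [subproblems_uniquely_solvable d] holds. *)
Definition DN2_step d f (f' : R) : Prop :=
  exists z1 mu1 z2 mu2 g,
    [/\ subproblem1 d f z1 mu1,
        is_left_derive z1 alpha g,
        subproblem2 d g z2 mu2
      & f' = (1 - theta) * f + theta * z2 alpha].

Definition DN2_iterates d (f0 : R) (f : nat -> R) : Prop :=
  f 0%N = f0 /\ forall k, DN2_step d (f k) (f k.+1).

Definition DN2_converges (n : nat) (d : 'I_n -> R) : Prop :=
  forall (f0 : 'I_n -> R) (f : 'I_n -> nat -> R),
    (forall i, DN2_iterates (d i) (f0 i) (f i)) ->
    forall i, f i k @[k --> \oo] --> (0 : R).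

Definition sigma d : R := Num.sqrt (d ^+ 2 + nu^-1).
Definition omega d : R := nu^-1 * gamma + d.

Definition DN2_factor d : R :=
  let s := sigma d in let w := omega d in
  let a := s * alpha in let b := s * (T - alpha) in
  1 - theta * (1 + coth a * ((s * coth b + w) / (s + w * coth b))).

(* The terms are nonnegative, so the base value 0 does not affect the maximum. *)
Definition rho_DN2 (n : nat) (d : 'I_n -> R) : R :=
  \big[Num.max/0]_(i < n) `|DN2_factor (d i)|.

End DN2.

(* Main.v *)
Require Import Defs.
From mathcomp Require Import all_boot all_order all_algebra.
From mathcomp Require Import all_classical all_reals all_analysis.
From mathcomp Require Import ring lra.
Import Order.TTheory GRing.Theory Num.Theory.
Import numFieldNormedType.Exports.
Local Open Scope classical_set_scope.
Local Open Scope ring_scope.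

(** Every solution of the subdomain system satisfies [z'' = sigma^2 z], so the
    subdomain problems are solved explicitly by hyperbolic functions, and unique
    solvability makes these the only solutions.  Eliminating the Neumann datum
    shows that one iteration multiplies the interface value by [DN2_factor], so
    the iterates form a geometric sequence. *)

Section Hyperbolic.
Context {R : realType}.
Implicit Types x s c p q t : R.

Lemma sinh0 : sinh (0 : R) = 0.
Proof. by rewrite /sinh oppr0 subrr mul0r. Qed.

Lemma cosh0 : cosh (0 : R) = 1.
Proof. by rewrite /cosh oppr0 expR0; field. Qed.

Lemma sinhN x : sinh (- x) = - sinh x.
Proof. by rewrite /sinh opprK; ring. Qed.

Lemma coshN x : cosh (- x) = cosh x.
Proof. by rewrite /cosh opprK; ring. Qed.

Lemma sinh_gt0 x : 0 < x -> 0 < sinh x.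
Proof.
by move=> x0; rewrite /sinh divr_gt0// subr_gt0 ltr_expR; lra.
Qed.

Lemma is_derive_sinh x : is_derive x 1 sinh (cosh x).
Proof.
rewrite (_ : sinh = fun y => 2^-1 *: (expR y - (expR \o -%R) y)); last first.
  by apply/funext => y; rewrite /sinh /= /GRing.scale /=; ring.
apply: is_derive_eq.
by rewrite /cosh /GRing.scale /=; ring.
Qed.

Lemma is_derive_cosh x : is_derive x 1 cosh (sinh x).
Proof.
rewrite (_ : cosh = fun y => 2^-1 *: (expR y + (expR \o -%R) y)); last first.
  by apply/funext => y; rewrite /cosh /= /GRing.scale /=; ring.
apply: is_derive_eq.
by rewrite /sinh /GRing.scale /=; ring.
Qed.

(** General solution of [z'' = s^2 z], with value [p] and slope [s * q] at [c]. Taking for [c] the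
    end that carries the homogeneous condition turns that condition into a linear relation between
    [p] and [q]. *)
Definition hyp s c p q t : R := p * cosh (s * (t - c)) + q * sinh (s * (t - c)).

Lemma is_derive_hyp s c p q t :
  is_derive t 1 (hyp s c p q) (hyp s c (s * q) (s * p) t).
Proof.
pose u := fun y : R => s *: (y - c).
have du : is_derive t 1 u s.
  by apply: is_derive_eq; rewrite /GRing.scale /=; ring.
rewrite (_ : hyp s c p q = fun y => p *: (cosh \o u) y + q *: (sinh \o u) y);
  last by apply/funext.
have dc := @is_derive1_comp _ cosh u t _ _ (is_derive_cosh (u t)) du.
have ds := @is_derive1_comp _ sinh u t _ _ (is_derive_sinh (u t)) du.
apply: is_derive_eq.
by rewrite /hyp /u /GRing.scale /=; ring.
Qed.

End Hyperbolic.

Section OneSidedDerivatives.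
Context {R : realType}.
Implicit Types (z w : R -> R) (x y l : R).

(** Away from [x] the difference quotient is Carathéodory's slope function, which is continuous at
    [x]. *)
Lemma is_derive_dnbhs z x l : is_derive x 1 z l ->
  (z t - z x) / (t - x) @[t --> x^'] --> l.
Proof.
move=> /is_derive1_caratheodory[g [zE /continuous_withinNx gC <-]].
apply: cvg_trans gC; apply: near_eq_cvg; near=> t.
rewrite zE mulfK// subr_eq0.
by near: t; exact: nbhs_dnbhs_neq.
Unshelve. all: by end_near. Qed.

Lemma is_derive_left z x l : is_derive x 1 z l -> is_left_derive z x l.
Proof. by move=> /is_derive_dnbhs; exact: cvg_dnbhs_at_left. Qed.

Lemma is_derive_right z x l : is_derive x 1 z l -> is_right_derive z x l.
Proof. by move=> /is_derive_dnbhs; exact: cvg_dnbhs_at_right. Qed.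

(** Unique solvability identifies solutions only on the closed subdomain; this carries the Neumann
    datum across such an identification. *)
Lemma is_left_derive_eq z w x y l : x < y -> {in `[x, y], z =1 w} ->
  is_left_derive w y l -> is_left_derive z y l.
Proof.
move=> xy zw; apply: cvg_trans; apply: near_eq_cvg; near=> t.
rewrite !zw// in_itv/= ?lexx ?(ltW xy)//.
by apply/andP; split; near: t; [exact: nbhs_left_ge|exact: nbhs_left_le].
Unshelve. all: by end_near. Qed.

Lemma is_left_derive_unique z x l1 l2 :
  is_left_derive z x l1 -> is_left_derive z x l2 -> l1 = l2.
Proof. exact: norm_cvg_unique. Qed.

End OneSidedDerivatives.

Lemma cvg_exprP {R : realType} (c : R) :
  c ^+ k @[k --> \oo] --> 0 <-> `|c| < 1.
Proof.
split=> [c0|]; last exact: cvg_expr.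
(* A single power of norm below 1 suffices, since [1 <= |c|] would keep every power at norm at least
   1. *)
have [k _ /(_ k (leqnn k)) /=] := cvgr0_norm_lt _ c0 _ ltr01.
rewrite normrX ltNge [`|c| < 1]ltNge; apply: contra.
exact: exprn_ege1.
Qed.

Section Subproblems.
Context {R : realType}.
Variables (nu gamma T alpha theta d : R).
Hypotheses (nu_gt0 : 0 < nu) (alpha_gt0 : 0 < alpha) (alpha_ltT : alpha < T).

Local Notation s := (sigma nu d).
Local Notation w := (omega nu gamma d).
Local Notation a := (s * alpha).
Local Notation b := (s * (T - alpha)).

Lemma sigma_gt0 : 0 < s.
Proof. by rewrite sqrtr_gt0 ltr_wpDl ?sqr_ge0 ?invr_gt0. Qed.

Lemma sqr_sigma : s ^+ 2 = d ^+ 2 + nu^-1.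
Proof. by rewrite sqr_sqrtr// addr_ge0 ?sqr_ge0 ?invr_ge0 ?ltW. Qed.

Lemma hyp_LRcontinuous c p q x y :
  derivable_oo_LRcontinuous (hyp s c p q) x y.
Proof.
have C t : hyp s c p q u @[u --> t] --> hyp s c p q t.
  apply: differentiable_continuous; apply/derivable1_diffP.
  by have := is_derive_hyp s c p q t => -[].
split; [|exact: cvg_at_right_filter|exact: cvg_at_left_filter].
by move=> t _; have := is_derive_hyp s c p q t => -[].
Qed.

(** The first equation forces [mu = nu * (z' + d * z)]; the second then reduces to
    [s^2 = d^2 + nu^-1]. *)
Lemma solves_ode_hyp c p q x y :
  solves_ode nu d x y (hyp s c p q)
    (hyp s c (nu * (s * q + d * p)) (nu * (s * p + d * q))).
Proof.
split; [exact: hyp_LRcontinuous|exact: hyp_LRcontinuous|move=> t _].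
have dh p' q' := is_derive_hyp s c p' q' t.
have nu0 : nu != 0 by rewrite gt_eqF.
have E r : nu * s ^+ 2 * r = nu * d ^+ 2 * r + r.
  by rewrite sqr_sigma; field.
rewrite !derive1E !derive_val /hyp; set ch := cosh _; set sh := sinh _.
split; first by field.
have := E (p * ch + q * sh).
by move=> /eqP; rewrite -subr_eq0 => /eqP H; rewrite -H; ring.
Qed.

Lemma subproblem1_hyp f : exists mu,
  subproblem1 nu alpha d f (hyp s 0 0 (f / sinh a)) mu.
Proof.
eexists; split; first exact: solves_ode_hyp.
  by rewrite /hyp subr0 mulr0 sinh0; ring.
rewrite /hyp subr0 mul0r add0r divfK// gt_eqF// sinh_gt0//.
by rewrite mulr_gt0// sigma_gt0.
Qed.

(** The condition at [T] reads [s * q + w * p = 0], hence [p = r * s] and [q = - (r * w)].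
    Parametrising by [r] instead of the datum avoids dividing by a coefficient not yet known to be
    nonzero. *)
Lemma subproblem2_hyp r : exists mu,
  subproblem2 nu gamma T alpha d (- (r * s * (s * sinh b + w * cosh b)))
    (hyp s T (r * s) (- (r * w))) mu.
Proof.
eexists; split; first exact: solves_ode_hyp.
  apply: is_derive_right; apply: is_derive_eq (is_derive_hyp _ _ _ _ _) _.
  rewrite /hyp -(opprB T) (mulrN _ (T - alpha)) coshN sinhN; ring.
rewrite /hyp subrr mulr0 sinh0 cosh0 /omega.
by field; rewrite gt_eqF.
Qed.

Hypothesis solvable : subproblems_uniquely_solvable nu gamma T alpha d.

(** Positivity is no help, as [w] may be negative. If the coefficient vanished, [r = 1] and [r = 0]
    would both solve the problem with zero datum, yet they take the distinct values [s] and [0] at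
    [T]. *)
Lemma neumann_coef_neq0 : s * sinh b + w * cosh b != 0.
Proof.
apply/eqP => D0.
have [mu1] := subproblem2_hyp 1; have [mu0] := subproblem2_hyp 0.
rewrite D0 !mulr0 => P0 P1.
have [_ /(_ _ _ _ _ P1 P0 T)] := solvable.2 (- 0).
rewrite in_itv/= lexx (ltW alpha_ltT) => /(_ isT)[+ _].
rewrite /hyp subrr mulr0 sinh0 cosh0 => H.
have := sigma_gt0; lra.
Qed.

Lemma DN2_stepP f f' :
  DN2_step nu gamma T alpha theta d f f' <->
  f' = DN2_factor nu gamma T alpha theta d * f.
Proof.
have D0 := neumann_coef_neq0.
have s0 : s != 0 by rewrite gt_eqF// sigma_gt0.
have sa0 : sinh a != 0 by rewrite gt_eqF// sinh_gt0// mulr_gt0// sigma_gt0.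
have sb0 : sinh b != 0.
  by rewrite gt_eqF// sinh_gt0// mulr_gt0 ?sigma_gt0 ?subr_gt0.
(* [g] is the slope at [alpha] of the explicit first solution, and [r] is the parameter giving the
   second one that slope. *)
pose g := s * (f / sinh a) * cosh a.
pose r := - (g / (s * (s * sinh b + w * cosh b))).
have [mu1 P1] := subproblem1_hyp f.
have [mu2 P2] := subproblem2_hyp r.
have gE : - (r * s * (s * sinh b + w * cosh b)) = g.
  by rewrite /r; field; rewrite D0 s0.
rewrite gE in P2.
have L1 : is_left_derive (hyp s 0 0 (f / sinh a)) alpha g.
  apply: is_derive_left; apply: is_derive_eq (is_derive_hyp _ _ _ _ _) _.
  by rewrite /hyp subr0 /g; ring.
have fE : (1 - theta) * f + theta * hyp s T (r * s) (- (r * w)) alpha =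
    DN2_factor nu gamma T alpha theta d * f.
  rewrite /hyp -(opprB T) (mulrN _ (T - alpha)) coshN sinhN.
  rewrite /DN2_factor /r /g /coth.
  by field; rewrite s0 sa0 sb0 D0.
split=> [[z1 [m1 [z2 [m2 [h [Q1 L Q2 ->]]]]]]|->].
  (* Uniqueness on each subdomain forces an arbitrary step to have the slope and the interface value
     of the explicit one. *)
  have z1E : {in `[0, alpha], hyp s 0 0 (f / sinh a) =1 z1}.
    by move=> t /((solvable.1 f).2 _ _ _ _ P1 Q1)[].
  have hE := is_left_derive_unique _ _ _ _
    (is_left_derive_eq _ _ _ _ _ alpha_gt0 z1E L) L1.
  rewrite hE in Q2; rewrite -fE.
  have [|-> //] := (solvable.2 g).2 _ _ _ _ P2 Q2 alpha.
  by rewrite in_itv/= lexx (ltW alpha_ltT).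
by exists (hyp s 0 0 (f / sinh a)), mu1, (hyp s T (r * s) (- (r * w))), mu2, g.
Qed.

Lemma DN2_iteratesP f0 f :
  DN2_iterates nu gamma T alpha theta d f0 f <->
  forall k, f k = DN2_factor nu gamma T alpha theta d ^+ k * f0.
Proof.
split=> [[f00 fS] k|fE].
  elim: k => [|k IH]; first by rewrite expr0 mul1r.
  by rewrite exprS -mulrA -IH; apply/DN2_stepP.
split; first by rewrite fE expr0 mul1r.
by move=> k; apply/DN2_stepP; rewrite !fE exprS mulrA.
Qed.

End Subproblems.

Theorem theorem5 (R : realType) (n : nat) (A : 'M[R]_n) (d : 'I_n -> R)
    (nu gamma T alpha theta : R)
    (A_sym : A^T = A)
    (A_eig : has_eigenvalues A d)
    (nu_gt0 : 0 < nu) (gamma_ge0 : 0 <= gamma) (T_gt0 : 0 < T)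
    (alpha_gt0 : 0 < alpha) (alpha_ltT : alpha < T)
    (solvable : forall i : 'I_n,
       subproblems_uniquely_solvable nu gamma T alpha (d i))
    (theta_gt0 : 0 < theta) (theta_lt1 : theta < 1) :
  DN2_converges nu gamma T alpha theta d <->
  rho_DN2 nu gamma T alpha theta d < 1.
Proof.
pose c i := DN2_factor nu gamma T alpha theta (d i).
have itP i :=
    DN2_iteratesP _ _ _ _ theta _ nu_gt0 alpha_gt0 alpha_ltT (solvable i).
split=> [conv|/bigmax_ltP[_ c1] f0 f itf i].
  apply/bigmax_ltP; split=> // i _; apply/cvg_exprP.
  (* Starting from 1 in every component, the iterates are exactly the powers of the factors. *)
  apply: (conv (fun=> 1) (fun i k => c i ^+ k) _ i) => j.
  by apply/itP => k; rewrite mulr1.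
rewrite (_ : f i = fun k => c i ^+ k * f0 i); last first.
  by apply/funext => k; rewrite ((itP i _ _).1 (itf i)).
rewrite -[X in _ --> X](mul0r (f0 i)); apply: cvgMl.
exact/cvg_exprP/c1.
Qed.
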